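(* Let $m\ge2$, $n\ge1$ and $1\le p\le n$ be integers. The maximal achievable value of the generalized Mermin expression $\mathcal M_{m,n}$ in the grouping model with maximal group size $p$ (i.e. over all partitions of the $n$ parties into groups each of size at most $p$, and all strategies compatible with such a partition) is $$\max_{p\text{-prod.}}\langle\mathcal M_{m,n}\rangle=C_{m,\lceil n/p\rceil}.$$
   Context: There are $n$ parties; party $j$ receives an input $x_j\in\{0,\dots,m-1\}$ and produces an output in $\{\pm1\}$. For $\bm x=(x_1,\dots,x_n)$ put $s(\bm x)=\sum_{j=1}^n x_j$ (an ordinary integer sum). If the outputs are functions $a_j(\bm x)\in\{\pm1\}$ of the inputs (in general of all the inputs the party has access to), the value of the generalized Mermin expression is $$\langle\mathcal M_{m,n}\rangle=\frac{1}{m^{n-1}}\sum_{\substack{\bm x\in\{0,\dots,m-1\}^n\\ s(\bm x)\equiv0\ (\mathrm{mod}\ m)}}(-1)^{s(\bm x)/m}\prod_{j=1}^n a_j(\bm x),$$ extended linearly to mixtures (shared randomness), which does not affect maxima. Local bound: for $k\ge 1$ parties, $C_{m,k}$ is the maximum of $\langle\mathcal M_{m,k}\rangle$ over local strategies, i.e. those in which each $a_j$ depends only on $x_j$, for $j=1,\dots,k$. Grouping model: the $n$ parties are partitioned into nonempty groups; arbitrary communication and collaboration is allowed within each group and none between distinct groups, i.e. the output of a party is an arbitrary function of the inputs of all parties in its own group (and shared randomness). Correlations are $p$-producible if they are generated by groupings in which every group has size at most $p$. *)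

(* Defs.v *)
From HB Require Import structures.
From mathcomp Require Import all_boot all_order all_algebra.

Set Implicit Arguments.
Unset Strict Implicit.
Unset Printing Implicit Defensive.

Import Order.TTheory GRing.Theory Num.Theory.

Local Open Scope ring_scope.

Definition inputs (m n : nat) := {ffun 'I_n -> 'I_m}.

Definition input_sum (m n : nat) (x : inputs m n) : nat :=
  (\sum_(j < n) x j)%N.

(* A deterministic strategy [a]: when the inputs are [x], party [j] outputs the
   sign [(-1) ^+ a j x].  A priori every output may depend on all the inputs. *)
Definition strategy (m n : nat) := {ffun 'I_n -> {ffun inputs m n -> bool}}.

Definition output (R : realFieldType) (m n : nat) (a : strategy m n)
    (j : 'I_n) (x : inputs m n) : R :=
  (-1) ^+ (a j x).

Definition mermin (R : realFieldType) (m n : nat) (a : strategy m n) : R :=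
  (m%:R ^+ n.-1)^-1 *
  \sum_(x : inputs m n | (m %| input_sum x)%N)
     (-1) ^+ (input_sum x %/ m)%N * \prod_(j < n) output R a j x.

Definition local_strategy (m n : nat) (a : strategy m n) : bool :=
  [forall j : 'I_n, forall x : inputs m n, forall y : inputs m n,
     (x j == y j) ==> (a j x == a j y)].

(* The seed of the [arg max] is the strategy always answering +1; it is local,
   so this is a genuine maximum. *)
Definition local_bound (R : realFieldType) (m k : nat) : R :=
  mermin R [arg max_(a > [ffun=> [ffun=> false]] : strategy m k
                       | local_strategy a) mermin R a]%O.

(* The output of [j] is a function of the inputs of the block of [P] that
   contains [j]. *)
Definition compatible (m n : nat) (P : {set {set 'I_n}}) (a : strategy m n) :
    bool :=
  [forall j : 'I_n, forall x : inputs m n, forall y : inputs m n,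
     [forall i in pblock P j, x i == y i] ==> (a j x == a j y)].

Definition grouping (n p : nat) (P : {set {set 'I_n}}) : bool :=
  partition P [set: 'I_n] && [forall B in P, (#|B| <= p)%N].

(* [L] is the set of values of the shared randomness and [w] its law.  As there
   are finitely many deterministic strategies, a finite [L] is no restriction. *)
Definition producible_value (R : realFieldType) (m n p : nat) (v : R) : Prop :=
  exists (P : {set {set 'I_n}}) (L : finType) (w : L -> R)
         (a : L -> strategy m n),
    [/\ grouping p P,
        (forall l, 0 <= w l) /\ \sum_l w l = 1,
        forall l, compatible P (a l)
      & v = \sum_l w l * mermin R (a l)].

Definition is_maximum (R : realFieldType) (A : R -> Prop) (v : R) : Prop :=
  A v /\ forall u, A u -> u <= v.

Definition ceil_div (n p : nat) : nat := `|Num.ceil (n%:R / p%:R : rat)|%N.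

(* Main.v *)
(** Merge the parties into [k] groups along a surjection [f], and write the sum
    of the inputs of a group as [S = m q + y] with [y < m].  The vector [y] is
    then an input of the [k]-party expression, and the extra sign [(-1) ^ q] can
    be absorbed into the output of the group.  Shifting the input of one
    representative per group lets [y] run over all inputs while every other
    coordinate is frozen, so a strategy compatible with the grouping is worth
    the average, over the frozen coordinates, of local [k]-party strategies.
    Conversely each local [k]-party strategy is the reduction of a grouped
    strategy whatever the frozen coordinates.  Since any partition into blocks
    of size at most [p] has at least [ceil (n / p)] blocks, it can be merged
    down to exactly [ceil (n / p)] groups. *)
Require Import Defs.
From mathcomp Require Import all_boot all_order all_algebra.

Set Implicit Arguments.
Unset Strict Implicit.
Unset Printing Implicit Defensive.

Import Order.TTheory GRing.Theory Num.Theory.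

Local Open Scope ring_scope.

(** * Ceiling, local bound and signs *)

Lemma ceil_div_leq (n p q : nat) :
  (0 < p)%N -> (ceil_div n p <= q)%N = (n <= q * p)%N.
Proof.
move=> p_gt0; rewrite /ceil_div.
have ceil_ge0 : 0 <= Num.ceil (n%:R / p%:R : rat).
  by rewrite ceil_ge0 (lt_le_trans (ltrN10 _)) // divr_ge0 ?ler0n.
rewrite -lez_nat gez0_abs // ceil_le_int.
by rewrite ler_pdivrMr ?ltr0n // -pmulrn -natrM ler_nat.
Qed.

Lemma local_bound_ge (R : realFieldType) (m k : nat) (a : strategy m k) :
  local_strategy a -> mermin R a <= local_bound R m k.
Proof.
rewrite /local_bound; case: arg_maxP => [|b _ b_max]; last exact: b_max.
by apply/'forall_'forall_forallP=> i x y; rewrite !ffunE eqxx implybT.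
Qed.

Lemma local_bound_attained (R : realFieldType) (m k : nat) :
  exists2 a : strategy m k, local_strategy a & mermin R a = local_bound R m k.
Proof.
rewrite /local_bound; case: arg_maxP => [|b b_loc _]; last by exists b.
by apply/'forall_'forall_forallP=> i x y; rewrite !ffunE eqxx implybT.
Qed.

Lemma sign_addb_big (R : realFieldType) (I : finType) (P : pred I)
    (F : I -> bool) :
  (-1) ^+ (\big[addb/false]_(i | P i) F i) = \prod_(i | P i) (-1) ^+ F i :> R.
Proof.
apply: (big_morph (fun b : bool => (-1) ^+ b : R)) => [b c|]; last exact: expr0.
exact: signr_addb.
Qed.

(** * Reduction to one party per group *)

Section Grouping.

Variables (m n k : nat) (f : 'I_n -> 'I_k) (r : 'I_k -> 'I_n).
Hypothesis rK : cancel r f.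

Definition group_sum (x : inputs m.+1 n) (g : 'I_k) : nat :=
  (\sum_(j | f j == g) x j)%N.

Definition group_residue (x : inputs m.+1 n) : inputs m.+1 k :=
  [ffun g => inord (group_sum x g %% m.+1)].

(** Addition is modulo [m.+1], so each fixed [w] permutes the inputs, while the residue of every
    group [g] moves by exactly [w g]. *)
Definition shift (z : inputs m.+1 n) (w : inputs m.+1 k) : inputs m.+1 n :=
  [ffun j => if j == r (f j) then z j + w (f j) else z j].

Definition fiber_point (z : inputs m.+1 n) (y : inputs m.+1 k) :=
  shift z [ffun g => y g - group_residue z g].

Definition reduced (a : strategy m.+1 n) (z : inputs m.+1 n) :
    strategy m.+1 k :=
  [ffun g => [ffun y =>
     odd (group_sum (fiber_point z y) g %/ m.+1)
     (+) \big[addb/false]_(j | f j == g) a j (fiber_point z y)]].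

Definition grouped (a : strategy m.+1 n) : Prop :=
  forall j (x y : inputs m.+1 n),
    (forall i, f i = f j -> x i = y i) -> a j x = a j y.

Lemma group_residueE x g :
  group_residue x g = \sum_(j | f j == g) x j :> 'I_m.+1.
Proof.
apply: val_inj; rewrite ffunE /= inordK ?ltn_pmod // /group_sum.
apply: (big_ind2 (fun (s : nat) (t : 'I_m.+1) => (s %% m.+1)%N = t)) => /=.
- by rewrite mod0n.
- by move=> s1 t1 s2 t2 <- <-; rewrite modnDm.
- by move=> i _; rewrite modn_small.
Qed.

Lemma group_residue_shift z w :
  group_residue (shift z w) = [ffun g => group_residue z g + w g].
Proof.
apply/ffunP=> g; rewrite [RHS]ffunE !group_residueE.
rewrite (bigD1 (r g)) ?rK //= [in RHS](bigD1 (r g)) ?rK //=.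
rewrite ffunE rK eqxx addrAC; congr (_ + _ + _).
apply: eq_bigr => j /andP[/eqP fj j_r]; rewrite ffunE fj.
by rewrite (negPf j_r).
Qed.

Lemma group_residue_fiber z y : group_residue (fiber_point z y) = y.
Proof.
rewrite group_residue_shift; apply/ffunP=> g; rewrite !ffunE.
by rewrite addrC subrK.
Qed.

Lemma input_sum_groups x :
  input_sum x =
  ((\sum_g group_sum x g %/ m.+1) * m.+1 + input_sum (group_residue x))%N.
Proof.
rewrite {1}/input_sum (partition_big f xpredT) //= big_distrl /= -big_split /=.
apply: eq_bigr => g _; rewrite ffunE inordK ?ltn_pmod //.
exact: divn_eq.
Qed.

(** Each [shift^~ w] is a bijection, so summing over all [z] and [w] counts every input [m.+1 ^ k]
    times. For fixed [z], passing from [w] to the residues [y] is a translation. *)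
Lemma reindex_shift (R : realFieldType) (F : inputs m.+1 n -> R) :
  \sum_x F x = (m.+1%:R ^+ k)^-1 * \sum_z \sum_y F (fiber_point z y).
Proof.
have -> : \sum_z \sum_y F (fiber_point z y) = \sum_z \sum_w F (shift z w).
  apply: eq_bigr => z _.
  pose h (w : inputs m.+1 k) : inputs m.+1 k :=
    [ffun g => group_residue z g + w g].
  rewrite (reindex h) /=.
    apply: eq_bigr => w _; congr (F (shift z _)).
    by apply/ffunP=> g; rewrite !ffunE addrC addKr.
  exists (fun y : inputs m.+1 k => [ffun g => y g - group_residue z g]) => w _;
    apply/ffunP=> g; rewrite !ffunE; first by rewrite addrC addKr.
  by rewrite addrC subrK.
have sum_shift w : \sum_z F (shift z w) = \sum_z F z.
  have inj_shift : injective (shift^~ w).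
    move=> z1 z2 /ffunP eq12; apply/ffunP=> j; move: (eq12 j).
    by rewrite !ffunE; case: ifP => // _ /addIr.
  by rewrite [RHS](reindex_inj inj_shift).
rewrite exchange_big /= (eq_bigr _ (fun w _ => sum_shift w)).
rewrite sumr_const card_ffun !card_ord -[_ *+ (_ ^ _)]mulr_natl natrX mulKf //.
by rewrite expf_neq0 ?pnatr_eq0.
Qed.

Lemma mermin_average (R : realFieldType) (a : strategy m.+1 n) :
  (0 < n)%N ->
  mermin R a = (m.+1%:R ^+ n)^-1 * \sum_z mermin R (reduced a z).
Proof.
move=> n_gt0; have k_gt0 : (0 < k)%N.
  by case: k f => [g|//]; case: (g (Ordinal n_gt0)).
rewrite /mermin big_mkcond [in LHS]reindex_shift -mulr_sumr /= !mulrA.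
congr (_ * _).
  (* Both normalisations have exponent [n + k - 1]; as [n] and [k] are positive, the predecessors
     are not truncated. *)
  rewrite -!invfM -!exprD; congr (_ ^+ _)^-1.
  by rewrite -[in RHS](prednK n_gt0) -[in LHS](prednK k_gt0) addSnnS.
apply: eq_bigr => z _; rewrite [RHS]big_mkcond; apply: eq_bigr => y _.
(* The group quotients contribute a multiple of [m.+1], so the divisibility test becomes that of [y]
   and the sign splits off one factor per group. *)
rewrite {1 2}input_sum_groups group_residue_fiber.
rewrite dvdn_addr ?dvdn_mull //; case: ifP => // _.
rewrite divnMDl // exprD [_ * (-1) ^+ (input_sum y %/ _)]mulrC -mulrA.
congr (_ * _).
rewrite (partition_big f xpredT) //= expr_sum -big_split /=.
apply: eq_bigr => g _.
by rewrite /output !ffunE signr_addb signr_odd sign_addb_big.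
Qed.

(** On the group [g], the point [fiber_point z y] depends only on [z] and [y g]. *)
Lemma reduced_local a z : grouped a -> local_strategy (reduced a z).
Proof.
move=> a_grp; apply/'forall_'forall_forallP=> g x y.
apply/implyP=> /eqP xy_g; rewrite !ffunE.
have eq_fiber i : f i = g -> fiber_point z x i = fiber_point z y i.
  by move=> fi; rewrite !ffunE fi xy_g.
apply/eqP; congr (odd (_ %/ _) (+) _).
  by apply: eq_bigr => j /eqP /eq_fiber ->.
apply: eq_bigr => j /eqP fj; apply: a_grp => i.
by rewrite fj => /eq_fiber.
Qed.

Lemma mermin_grouped_le (R : realFieldType) (a : strategy m.+1 n) :
  (0 < n)%N -> grouped a -> mermin R a <= local_bound R m.+1 k.
Proof.
move=> n_gt0 a_grp; rewrite mermin_average //.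
have M_gt0 : (0 : R) < m.+1%:R ^+ n by rewrite exprn_gt0 ?ltr0n.
rewrite mulrC ler_pdivrMr // -natrX mulr_natr.
have -> : (m.+1 ^ n)%N = #|inputs m.+1 n| by rewrite card_ffun !card_ord.
rewrite -sumr_const; apply: ler_sum => z _.
exact/local_bound_ge/reduced_local.
Qed.

(* The quotient of the group sum is added to cancel the sign absorbed by
   [reduced]. *)
Definition lift_strategy (c : strategy m.+1 k) : strategy m.+1 n :=
  [ffun j => [ffun x =>
     (j == r (f j)) &&
     (odd (group_sum x (f j) %/ m.+1) (+) c (f j) (group_residue x))]].

Lemma lift_strategy_grouped c : local_strategy c -> grouped (lift_strategy c).
Proof.
move=> c_loc j x y eq_xy; rewrite !ffunE.
have eq_sum : group_sum x (f j) = group_sum y (f j).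
  by apply: eq_bigr => i /eqP /eq_xy ->.
rewrite eq_sum; congr (_ && (_ (+) _)); apply/eqP.
apply: (implyP (forallP (forallP (forallP c_loc _) _) _)).
by rewrite !ffunE eq_sum.
Qed.

Lemma reduced_lift_strategy c z : reduced (lift_strategy c) z = c.
Proof.
apply/ffunP=> g; apply/ffunP=> y; rewrite !ffunE.
(* Only the representative can answer [true], so its term is the whole xor. *)
rewrite (bigD1 (r g)) ?rK //= big1 => [|j /andP[/eqP fj j_r]].
  by rewrite !ffunE rK eqxx /= addbF group_residue_fiber addKb.
by rewrite !ffunE fj (negPf j_r).
Qed.

Lemma mermin_lift_strategy (R : realFieldType) c :
  (0 < n)%N -> mermin R (lift_strategy c) = mermin R c.
Proof.
move=> n_gt0; rewrite mermin_average //.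
under eq_bigr do rewrite reduced_lift_strategy.
rewrite sumr_const card_ffun !card_ord -[_ *+ (_ ^ _)]mulr_natl natrX mulKf //.
by rewrite expf_neq0 ?pnatr_eq0.
Qed.

End Grouping.

(** * Partitions and maps onto groups *)

Lemma compatible_grouped (m n k : nat) (P : {set {set 'I_n}}) (f : 'I_n -> 'I_k)
    (a : strategy m.+1 n) :
    (forall i j, i \in pblock P j -> f i = f j) ->
  compatible P a -> grouped f a.
Proof.
move=> P_f a_comp j x y eq_xy; apply/eqP.
apply: (implyP (forallP (forallP (forallP a_comp j) x) y)).
by apply/forall_inP=> i /P_f /eq_xy ->.
Qed.

(** Merging blocks only enlarges what an output may depend on, so the bound for exactly [k] groups
    becomes applicable. *)
Lemma grouping_merge (n p k : nat) (P : {set {set 'I_n}}) :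
    grouping p P -> (0 < k)%N -> (k <= #|P|)%N ->
  exists (f : 'I_n -> 'I_k) (r : 'I_k -> 'I_n),
    cancel r f /\ forall i j, i \in pblock P j -> f i = f j.
Proof.
case: k => // k /andP[/and3P[/eqP covP tiP P0] _] _ k_le.
(* Blocks are numbered along [enum P]; all those of index at least [k] go to the last group. *)
pose f j : 'I_k.+1 := inord (minn k (index (pblock P j) (enum P))).
have f_surj (g : 'I_k.+1) : exists j, f j == g.
  have g_lt : (g < size (enum P))%N by rewrite -cardE (leq_trans (ltn_ord g)).
  pose B := nth set0 (enum P) g.
  have BP : B \in P by rewrite -mem_enum mem_nth.
  have [j jB] : exists j, j \in B by apply/set0Pn; apply: contraNneq P0 => <-.
  exists j; apply/eqP; rewrite /f (def_pblock tiP BP jB).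
  by rewrite index_uniq ?enum_uniq //= (minn_idPr (leq_ord g)) inord_val.
exists f, (fun g => xchoose (f_surj g)); split=> [g|i j ij].
  exact/eqP/(xchooseP (f_surj g)).
by rewrite /f (same_pblock tiP ij).
Qed.

Lemma grouping_card (n p : nat) (P : {set {set 'I_n}}) :
  grouping p P -> (n <= #|P| * p)%N.
Proof.
move=> /andP[P_part /forall_inP P_le].
rewrite -[X in (X <= _)%N](card_ord n) -cardsT (card_partition P_part).
by rewrite -sum_nat_const; apply: leq_sum => B /P_le.
Qed.

Lemma consecutive_groups (n p k : nat) :
    (0 < p)%N -> (forall q, (k <= q)%N = (n <= q * p)%N) ->
  exists (f : 'I_n -> 'I_k) (r : 'I_k -> 'I_n),
    cancel r f /\ forall g, (#|[set j | f j == g]| <= p)%N.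
Proof.
move=> p_gt0 kP.
have f_lt (j : 'I_n) : (j %/ p < k)%N.
  by rewrite ltn_divLR // (leq_trans (ltn_ord j)) // -kP.
(* The groups are intervals of length [p], represented by their first party; [kP] at [g] says that
   this party exists. *)
have r_lt (g : 'I_k) : (g * p < n)%N by rewrite ltnNge -kP -ltnNge.
exists (fun j => Ordinal (f_lt j)), (fun g => Ordinal (r_lt g)).
split=> [g|g]; first by apply: val_inj; rewrite /= mulnK.
(* The quotient by [p] is constant on a group, so the remainder is injective there. *)
pose h (j : 'I_n) : 'I_p := Ordinal (ltn_pmod j p_gt0).
rewrite -[X in (_ <= X)%N]card_ord -(card_in_imset (f := h)) ?max_card //.
move=> i j; rewrite !inE => /eqP <- /eqP/(congr1 val) /= eq_div.
move=> /(congr1 val) /= eq_mod; apply: val_inj => /=.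
by rewrite (divn_eq i p) (divn_eq j p) eq_mod eq_div.
Qed.

Lemma fibers_grouping (n p k : nat) (f : 'I_n -> 'I_k) :
    (forall g, (#|[set j | f j == g]| <= p)%N) ->
  grouping p (preim_partition f [set: 'I_n]).
Proof.
move=> f_le; rewrite /grouping preim_partitionP /=.
apply/forall_inP=> B /imsetP[j _ ->].
apply: leq_trans (f_le (f j)); rewrite subset_leq_card //.
by apply/subsetP=> i; rewrite !inE eq_sym.
Qed.

Lemma grouped_compatible (m n k : nat) (f : 'I_n -> 'I_k)
    (a : strategy m.+1 n) :
  grouped f a -> compatible (preim_partition f [set: 'I_n]) a.
Proof.
move=> a_grp; apply/'forall_'forall_forallP=> j x y.
apply/implyP=> /forall_inP eq_xy; apply/eqP/a_grp => i fi.
apply/eqP/eq_xy; rewrite pblock_equivalence_partition ?inE //.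
  by rewrite /= fi.
by move=> ? ? ? _ _ _; split=> [|/eqP ->].
Qed.

Theorem corollary2 (R : realFieldType) (m n p : nat)
    (hm : (2 <= m)%N) (hn : (1 <= n)%N) (hp : (1 <= p)%N) (hpn : (p <= n)%N) :
  is_maximum (@producible_value R m n p) (local_bound R m (ceil_div n p)).
Proof.
case: m hm => // m _; have kP q := ceil_div_leq n q hp.
split.
  have [f [r [rK f_le]]] := consecutive_groups hp kP.
  have [c c_loc <-] := local_bound_attained R m.+1 (ceil_div n p).
  (* A one-point seed space: the maximum is reached deterministically. *)
  exists (preim_partition f [set: 'I_n]), unit, (fun=> 1),
    (fun=> lift_strategy f r c); split.
  - exact: fibers_grouping.
  - by split=> [_|]; rewrite ?ler01 // sumr_const card_unit.
  - by move=> _; apply/grouped_compatible/lift_strategy_grouped.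
  - by rewrite sumr_const card_unit mul1r mermin_lift_strategy.
move=> _ [P [L [w [a [P_grp [w_ge0 w1] a_comp ->]]]]].
have k_gt0 : (0 < ceil_div n p)%N by rewrite ltnNge kP mul0n -ltnNge.
have k_le : (ceil_div n p <= #|P|)%N by rewrite kP grouping_card.
have [f [r [rK f_P]]] := grouping_merge P_grp k_gt0 k_le.
(* The weights sum to 1, so it suffices to bound each deterministic strategy. *)
rewrite -[leRHS]mul1r -w1 mulr_suml; apply: ler_sum => l _.
apply: ler_wpM2l => //; apply: (mermin_grouped_le rK) => //.
exact: compatible_grouped f_P (a_comp l).
Qed.
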